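(* Let $n$ be an even positive integer and $b$ a positive integer with $n-2b$ a positive (even) integer. If there exists a $(2,k_*,\lambda_* )$ orthogonal array and $4\lambda_*$ divides $b(n-b)$, then there exists a $k_*$-IMOFS$(n;n-2b)$.
   Context: A $(2,k_*,\lambda_* )$ orthogonal array is a $4\lambda_*\times k_*$ array with entries from a $2$-element set such that in every pair of distinct columns each of the $4$ ordered pairs of symbols occurs in exactly $\lambda_*$ rows. For positive even integers $s<n$, an incomplete frequency square of type $(n;s)$ is an $n\times n$ array indexed by $\{1,\dots,n\}^2$ whose cells in $\{1,\dots,s\}\times\{1,\dots,s\}$ are empty, whose other cells contain $0$ or $1$, and in which every row and every column contains equally many $0$'s and $1$'s. Two such arrays are orthogonal if, when superimposed (on the non-empty cells), each of the ordered pairs $(0,0),(0,1),(1,0),(1,1)$ occurs the same number of times. A $k$-IMOFS$(n;s)$ is a set of $k$ pairwise orthogonal incomplete frequency squares of type $(n;s)$. *)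

(* Defs.v *)
From mathcomp Require Import all_boot all_algebra.
Set Implicit Arguments.
Unset Strict Implicit.
Unset Printing Implicit Defensive.

Definition orthogonal_array (T : finType) (k lambda : nat)
    (A : 'M[T]_(4 * lambda, k)) : Prop :=
  #|T| = 2 /\
  forall (j1 j2 : 'I_k), j1 != j2 -> forall x y : T,
    #|[set i | (A i j1 == x) && (A i j2 == y)]| = lambda.

(* Arrays are 'M[option bool]_n: None is an empty cell, Some false and        *)
(* Some true are the symbols 0 and 1. Indices run from 0, so the empty        *)
(* subarray {1,..,s} x {1,..,s} is given by i < s and j < s.                  *)
Definition incomplete_frequency_square (n s : nat)
    (F : 'M[option bool]_n) : Prop :=
  [/\ forall i j : 'I_n, F i j = None <-> (i < s) && (j < s),
      forall i : 'I_n,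
        #|[set j | F i j == Some false]| = #|[set j | F i j == Some true]|
    & forall j : 'I_n,
        #|[set i | F i j == Some false]| = #|[set i | F i j == Some true]|].

Definition superposition_count (n : nat) (F G : 'M[option bool]_n)
    (x y : bool) : nat :=
  #|[set c : 'I_n * 'I_n | (F c.1 c.2 == Some x) && (G c.1 c.2 == Some y)]|.

Definition orthogonal_squares (n : nat) (F G : 'M[option bool]_n) : Prop :=
  forall x y x' y' : bool,
    superposition_count F G x y = superposition_count F G x' y'.

Definition IMOFS (k n s : nat) (S : {set 'M[option bool]_n}) : Prop :=
  [/\ #|S| = k,
      forall F, F \in S -> incomplete_frequency_square s F
    & forall F G, F \in S -> G \in S -> F != G -> orthogonal_squares F G].

(* Main.v *)
Require Import Defs.
From mathcomp Require Import all_boot all_algebra.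
From mathcomp Require Import zify.

(** Cut the array into 2 x 2 blocks; the nonempty region consists of b(n - b)
    of them.  Filling a block with [x, 1-x; 1-x, x] balances every row and
    column whatever the bit x is.  Number the blocks and let the j-th square
    take the bit of block m from row m mod 4 lambda and column j of the
    orthogonal array: since 4 lambda divides the number of blocks, every pair
    of symbols is hit by equally many blocks, for each of the four cell
    positions inside a block. *)

Lemma sum_nat_divmod (r w : nat) (f : nat -> nat) :
  \sum_(0 <= p < r) \sum_(0 <= c < w) f (p * w + c) =
  \sum_(0 <= m < r * w) f m.
Proof.
elim: r => [|r IHr]; first by rewrite !big_geq.
rewrite big_nat_recr //= IHr mulSnr.
rewrite [RHS](big_cat_nat (n := r * w)) ?leq_addr //=.
congr (_ + _); rewrite -{2}[r * w]add0n big_addn addKn.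
by apply: eq_bigr => c _; rewrite addnC.
Qed.

(** The range splits into [q] full periods of length [m], each contributing the same sum. *)
Lemma sum_nat_modn (q m : nat) (f : nat -> nat) :
  \sum_(0 <= i < q * m) f (i %% m) = q * \sum_(0 <= i < m) f i.
Proof.
rewrite -(sum_nat_divmod q m (fun i => f (i %% m))) -[q in RHS]subn0.
rewrite -sum_nat_const_nat.
apply: eq_bigr => p _; rewrite !big_nat; apply: eq_bigr => c /andP[_ lt_c].
by rewrite modnMDl modn_small.
Qed.

Lemma sum_nat_double (h : nat) (f : nat -> nat) :
  \sum_(0 <= i < h.*2) f i = \sum_(0 <= i < h) (f i.*2 + f i.*2.+1).
Proof.
elim: h => [|h IHh]; first by rewrite !big_geq.
by rewrite doubleS !big_nat_recr //= IHh addnA.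
Qed.

Lemma sum_nat_ord2 (n : nat) (f : nat -> nat -> bool) :
  #|[set c : 'I_n * 'I_n | f c.1 c.2]| =
  \sum_(0 <= i < n) \sum_(0 <= j < n) f i j.
Proof.
rewrite big_mkord -sum1dep_card big_mkcond /=.
rewrite (eq_bigr (fun c : 'I_n * 'I_n => f c.1 c.2 : nat)); last first.
  by move=> c _; case: (f _ _).
rewrite -(pair_bigA _ (fun i j : 'I_n => f i j : nat)) /=.
by apply: eq_bigr => i _; rewrite big_mkord.
Qed.

(** Row-by-row numbering of the nonempty blocks: each of the top [t] block rows has [b] of them,
    starting at block column [t], and each lower row has all [t + b]. On the empty corner the value
    is a dummy. *)
Definition block_number (t b p q : nat) : nat :=
  if p < t then p * b + (q - t) else t * b + ((p - t) * (t + b) + q).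

(** The numbering hits each value below the bound exactly once: the top band gives those below
    [t * b], the bottom band the rest. *)
Lemma sum_block_number (t b : nat) (f : nat -> nat) :
  \sum_(0 <= p < t + b) \sum_(0 <= q < t + b)
     (if (p < t) && (q < t) then 0 else f (block_number t b p q)) =
  \sum_(0 <= m < b * (t + (t + b))) f m.
Proof.
have -> : b * (t + (t + b)) = t * b + b * (t + b) by nia.
rewrite (big_cat_nat (n := t)) ?leq_addr //=.
rewrite [RHS](big_cat_nat (n := t * b)) ?leq_addr //=; congr (_ + _).
  rewrite -sum_nat_divmod !big_nat; apply: eq_bigr => p /andP[_ lt_pt].
  rewrite (big_cat_nat (n := t)) ?leq_addr //= big_nat big1 ?add0n; last first.
    by move=> q /andP[_ lt_qt]; rewrite lt_pt lt_qt.
  rewrite -{1}[t]add0n big_addn addKn; apply: eq_bigr => q _.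
  by rewrite /block_number lt_pt /= ltnNge leq_addl addnK.
rewrite -{1}[t]add0n -{1}[t * b]add0n !big_addn !addKn.
rewrite -(sum_nat_divmod b (t + b) (fun m => f (m + t * b))).
apply: eq_bigr => p _; apply: eq_bigr => q _.
by rewrite /block_number ltnNge leq_addl /= addnK [in RHS]addnC.
Qed.

Definition block_cell (t : nat) (v : nat -> nat -> bool) (i j : nat) :
    option bool :=
  if (i./2 < t) && (j./2 < t) then None
  else Some (v i./2 j./2 (+) (odd i (+) odd j)).

Definition block_square (n t : nat) (v : nat -> nat -> bool) :
    'M[option bool]_n :=
  \matrix_(i, j) block_cell t v i j.

(** The other index of the pair [2p], [2p + 1] that one block occupies. *)
Definition block_partner (i : nat) : nat := if odd i then i.-1 else i.+1.

Lemma odd_block_partner (i : nat) : odd (block_partner i) = ~~ odd i.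
Proof. by rewrite /block_partner; case: ifP; case: i => //= i; lia. Qed.

Lemma block_partnerK : involutive block_partner.
Proof.
move=> i; rewrite {1}/block_partner odd_block_partner /block_partner.
by case: (odd i) (@odd_gt0 i) => /= i_gt0; rewrite ?prednK ?i_gt0.
Qed.

Lemma half_block_partner (i : nat) : (block_partner i)./2 = i./2.
Proof. by rewrite /block_partner; case: ifP; lia. Qed.

Lemma ltn_block_partner (n i : nat) : ~~ odd n -> i < n -> block_partner i < n.
Proof. by rewrite /block_partner; case: ifP; lia. Qed.

(** Passing to the partner is an involution of the indices, [n] being even, and it exchanges the
    cells holding 0 with those holding 1. *)
Lemma balanced_block_partner (n : nat) (f : nat -> option bool) :
    ~~ odd n -> (forall i, f (block_partner i) = omap negb (f i)) ->
  #|[set i : 'I_n | f i == Some false]| = #|[set i : 'I_n | f i == Some true]|.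
Proof.
move=> n_even f_partner.
pose g (i : 'I_n) := Ordinal (ltn_block_partner _ _ n_even (ltn_ord i)).
have gK : involutive g by move=> i; apply/val_inj/block_partnerK.
rewrite -[LHS](card_imset _ (inv_inj gK)); apply: eq_card => i.
rewrite -{1}[i]gK mem_imset ?inE /=; last exact: inv_inj.
by rewrite f_partner; case: (f i) => [[]|].
Qed.

Lemma block_square_frequency (n t : nat) (v : nat -> nat -> bool) :
  ~~ odd n -> incomplete_frequency_square t.*2 (block_square n t v).
Proof.
move=> n_even; split=> [i j|i|j].
- by rewrite mxE /block_cell -!ltn_half_double; case: ifP.
- have eqF x : [set j | block_square n t v i j == Some x] =
               [set j : 'I_n | block_cell t v i j == Some x].
    by apply/setP=> j; rewrite !inE mxE.
  rewrite !eqF; apply: (balanced_block_partner n (block_cell t v i)) => // j.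
  rewrite /block_cell half_block_partner odd_block_partner.
  by case: ifP => //= _; rewrite !addbN.
- have eqF x : [set i | block_square n t v i j == Some x] =
               [set i : 'I_n | block_cell t v i j == Some x].
    by apply/setP=> i; rewrite !inE mxE.
  rewrite !eqF.
  apply: (balanced_block_partner n (block_cell t v ^~ j)) => // i.
  rewrite /block_cell half_block_partner odd_block_partner.
  by case: ifP => //= _; rewrite addNb addbN.
Qed.

(** Two cells of a block show its pair of bits and the other two the complementary pair. So [N]
    blocks of each kind give [2 * N + 2 * N] cells. *)
Lemma block_square_superposition (h t N : nat) (v w : nat -> nat -> bool) :
    (forall x y, \sum_(0 <= p < h) \sum_(0 <= q < h)
       (if (p < t) && (q < t) then 0 else (v p q == x) && (w p q == y)) = N) ->
  forall x y, superposition_count (block_square h.*2 t v)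
                                  (block_square h.*2 t w) x y = 4 * N.
Proof.
move=> count_vw x y; rewrite /superposition_count.
(* The parity of the cell is moved from the entries to the symbols sought. *)
pose f i j := ~~ ((i./2 < t) && (j./2 < t)) &&
  ((v i./2 j./2 == x (+) (odd i (+) odd j)) &&
   (w i./2 j./2 == y (+) (odd i (+) odd j))).
rewrite (_ : [set _ | _] = [set c : 'I_h.*2 * 'I_h.*2 | f c.1 c.2]); last first.
  apply/setP=> -[i j]; rewrite !inE !mxE /= /block_cell {}/f.
  case: ifP => //= _.
  rewrite -[Some _ == Some x]/(_ == x) -[Some _ == Some y]/(_ == y).
  by case: (v _ _); case: (w _ _); case: (odd i (+) _); case: x; case: y.
rewrite sum_nat_ord2 sum_nat_double.
(* One sum for each cell position in a block: the symbols are complemented at the two off-diagonal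
   positions. *)
rewrite (eq_bigr (fun p => \sum_(0 <= q < h)
   (if (p < t) && (q < t) then 0 else (v p q == x) && (w p q == y))
 + \sum_(0 <= q < h)
   (if (p < t) && (q < t) then 0 else (v p q == ~~ x) && (w p q == ~~ y))
 + (\sum_(0 <= q < h)
   (if (p < t) && (q < t) then 0 else (v p q == ~~ x) && (w p q == ~~ y))
 + \sum_(0 <= q < h)
   (if (p < t) && (q < t) then 0 else (v p q == x) && (w p q == y)))));
  last first.
  move=> p _; rewrite !sum_nat_double -!big_split /=; apply: eq_bigr => q _.
  rewrite /f !oddS !odd_double -!uphalfE !uphalf_double !doubleK /=.
  by rewrite ?addbF ?addbT; case: ifP.
rewrite !big_split /= !count_vw; lia.
Qed.

Lemma card2_inj_bool (T : finType) :
  #|T| = 2 -> exists2 f : T -> bool, injective f & forall x, exists t, f t = x.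
Proof.
move=> T2; have cardTb : #|T| = #|{: bool}| by rewrite T2 card_bool.
pose f t : bool := enum_val (cast_ord cardTb (enum_rank t)).
have f_inj : injective f.
  by move=> s t /enum_val_inj/cast_ord_inj/enum_rank_inj.
exists f => // x.
have /codomP[t ->] := inj_card_onto f_inj (eq_leq (esym cardTb)) x.
by exists t.
Qed.

Theorem theorem6p6 (n b k lambda : nat)
  (n_gt0 : 0 < n) (n_even : ~~ odd n) (b_gt0 : 0 < b) (s_gt0 : 0 < n - 2 * b)
  (oa : exists (T : finType) (A : 'M[T]_(4 * lambda, k)), orthogonal_array A)
  (dvd : 4 * lambda %| b * (n - b)) :
  exists S : {set 'M[option bool]_n}, IMOFS k (n - 2 * b) S.
Proof.
case: oa => T [A [T2 A_oa]]; have [f f_inj f_surj] := card2_inj_bool _ T2.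
(* The empty subarray has [t] blocks per side, the whole square [t + b]. *)
pose t := n./2 - b.
have def_n : n = (t + b).*2 by rewrite /t; lia.
have def_s : n - 2 * b = t.*2 by rewrite /t; lia.
have def_bn : b * (n - b) = b * (t + (t + b)).
  by rewrite def_n; congr (_ * _); lia.
have {dvd} /dvdnP[q def_q] : 4 * lambda %| b * (t + (t + b)) by rewrite -def_bn.
(* A positive number of blocks forces [q] and [lambda] to be positive, which makes reduction mod
   [4 * lambda] a row index and later separates the squares. *)
have : 0 < b * (t + (t + b)) by rewrite muln_gt0 b_gt0 /=; lia.
rewrite def_q !muln_gt0 => /and3P[q_gt0 _ lambda_gt0].
have M_gt0 : 0 < 4 * lambda by rewrite muln_gt0.
rewrite {n_gt0 s_gt0 def_bn} def_s def_n in n_even *.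
pose row_of m : 'I_(4 * lambda) := Ordinal (ltn_pmod m M_gt0).
pose v j p r := f (A (row_of (block_number t b p r)) j).
pose F j := block_square (t + b).*2 t (v j).
have count_F j1 j2 x y : j1 != j2 ->
    superposition_count (F j1) (F j2) x y = 4 * (q * lambda).
  move=> neq_j; apply: block_square_superposition => {}x {}y.
  pose g m : nat := (f (A (row_of m) j1) == x) && (f (A (row_of m) j2) == y).
  rewrite (sum_block_number t b g) def_q.
  (* Only the residue of the block number matters, so each row of the orthogonal array serves [q]
     blocks. *)
  have g_mod m : g m = g (m %% (4 * lambda)).
    rewrite /g (_ : row_of (m %% _) = row_of m) //.
    by apply: val_inj; rewrite /= modn_mod.
  under eq_bigr do rewrite g_mod.
  rewrite sum_nat_modn; congr (_ * _).
  have [tx def_x] := f_surj x; have [ty def_y] := f_surj y.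
  rewrite -[RHS](A_oa _ _ neq_j tx ty) -sum1dep_card.
  rewrite big_mkord [RHS]big_mkcond /=.
  apply: eq_bigr => i _; rewrite /g -def_x -def_y !(inj_eq f_inj).
  have -> : row_of i = i by apply: val_inj; rewrite /= modn_small.
  by case: (_ && _).
(* Equal squares never superimpose to the pair (0,1), whereas distinct columns produce it
   [4 * (q * lambda) > 0] times; hence there are [k] different squares. *)
have F_inj : injective F.
  move=> j1 j2 eq_F; apply/eqP/negPn/negP => /(count_F _ _ false true) cnt.
  have : superposition_count (F j1) (F j2) false true = 0.
    rewrite eq_F /superposition_count; apply: eq_card0 => c; rewrite !inE.
    by case: (F j2 c.1 c.2) => [[]|].
  by rewrite cnt; move: q_gt0 lambda_gt0; nia.
exists (F @: [set: 'I_k]); split.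
- by rewrite card_imset // cardsT card_ord.
- by move=> _ /imsetP[j _ ->]; apply: block_square_frequency.
- move=> _ _ /imsetP[j1 _ ->] /imsetP[j2 _ ->] neq_F x y x' y'.
  by rewrite !count_F //; apply: contraNneq neq_F => ->.
Qed.
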